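(* Let $\mathcal H$ be a complex separable infinite-dimensional Hilbert space, let $T\in L(\mathcal H)$ and let $f_0\in\mathcal V_{\mathbb N}(T)$. Then $$\mathcal V_{\mathbb N}(T)=\left\{Vf_0:V\in\{T\}'\cap GL(\mathcal H)\right\}.$$
   Context: $\mathbb N=\{0,1,2,\dots\}$. $L(\mathcal H)$ is the set of bounded linear operators on $\mathcal H$, $GL(\mathcal H)$ the set of bijective ones. $\mathcal V_{\mathbb N}(T):=\{f\in\mathcal H:(T^nf)_{n\in\mathbb N}\text{ is a frame for }\mathcal H\}$, where a system $(f_n)_{n\in I}$ is a frame for $\mathcal H$ if there are $A,B>0$ with $A\|f\|^2\le\sum_{n\in I}|\langle f,f_n\rangle|^2\le B\|f\|^2$ for all $f\in\mathcal H$. $\{T\}'$ is the commutant of $T$, i.e. the set of all $V\in L(\mathcal H)$ commuting with $T$. *)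

(* Defs.v *)
From HB Require Import structures.
From mathcomp Require Import all_boot all_order all_algebra.
From mathcomp Require Import complex.
From mathcomp Require Import boolp classical_sets functions cardinality reals ereal.
From mathcomp Require Import topology normedtype sequences esum.

Set Implicit Arguments.
Unset Strict Implicit.
Unset Printing Implicit Defensive.

Import Order.TTheory GRing.Theory Num.Theory.
Import numFieldNormedType.Exports.

Local Open Scope classical_set_scope.
Local Open Scope ring_scope.

(* Over the scalars R[i] the library norm `|x| takes values in R[i]; it is
   always a nonnegative real there, so taking the real part loses nothing. *)
Definition rnorm (R : realType) (V : normedZmodType R[i]) (x : V) : R :=
  complex.Re `|x|.

Definition separable (T : topologicalType) : Prop :=
  exists2 D : set T, countable D & dense D.

(* No finite family spans V. *)
Definition infinite_dimensional (K : fieldType) (V : lmodType K) : Prop :=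
  forall (n : nat) (v : 'I_n -> V),
    exists x : V, forall c : 'I_n -> K, x <> \sum_(i < n) c i *: v i.

Definition bounded_operators (R : realType) (H : completeNormedModType R[i]) :
    set {linear H -> H} :=
  [set V | exists M : R, forall x : H, rnorm (V x) <= M * rnorm x].

Definition GL (R : realType) (H : completeNormedModType R[i]) :
    set {linear H -> H} :=
  [set V | bounded_operators V /\ bijective V].
Arguments GL {R} H.

Definition commutant (R : realType) (H : completeNormedModType R[i])
    (T : {linear H -> H}) : set {linear H -> H} :=
  [set V | bounded_operators V /\ forall x : H, V (T x) = T (V x)].

(* The forms {dot H for theta} are linear in the first argument and
   theta-semilinear in the second; esum is the unordered sum in [0, +oo]. *)
Definition frame (R : realType) (H : completeNormedModType R[i])
    (dot : {dot H for @Num.conj R[i]}) (I : choiceType) (f : I -> H) : Prop :=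
  exists A B : R, [/\ 0 < A, 0 < B & forall g : H,
    ((A * rnorm g ^+ 2)%:E <= \esum_(i in [set: I]) (rnorm (dot g (f i)) ^+ 2)%:E)%E
    /\ (\esum_(i in [set: I]) (rnorm (dot g (f i)) ^+ 2)%:E <= (B * rnorm g ^+ 2)%:E)%E].

(* The vectors whose forward orbit under T is a frame, usually written V_N(T). *)
Definition frame_generators (R : realType) (H : completeNormedModType R[i])
    (dot : {dot H for @Num.conj R[i]}) (T : {linear H -> H}) : set H :=
  [set f | frame dot (fun n : nat => iter n T f)].

(* Main.v *)
(* Write U_f c = \sum_k c_k T^k f for the synthesis operator of f on l^2, and S
   for the right shift, so that T U_f = U_f S.  For two generators f, h the map
   V : U_f c |-> U_h c is the required element of the commutant as soon as
   ker U_f = ker U_h.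

   If w in ker U_f is orthogonal to S (ker U_f), then w is orthogonal to all its
   own translates, hence convolution by w is bounded on l^2.  Summing this bound
   along antidiagonals shows that the truncations w_0 + ... + w_(j-1) T^(j-1),
   applied to the orbit of f and tested against a vector g, have l^2-norms that
   are bounded for infinitely many j; these sequences tend to 0 pointwise since
   U_f w = 0.  Expanding h in the orbit of f then gives U_h w = 0.  A general
   c in ker U_f is w + S c' with w as above, c' in ker U_f and |c'| <= |c|, where
   the orthogonal projection comes from the canonical dual frame; iterating,
   U_h c = U_h (S^n c_n) with bounded c_n, which tends to 0 weakly.

   Conversely, for V in the commutant, T^n (V f) = V T^n f, and the lower frame
   bound follows from the surjectivity of V by uniform boundedness. *)
Require Import Defs.
From HB Require Import structures.
From mathcomp Require Import all_boot all_order all_algebra.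
From mathcomp Require Import complex.
From mathcomp Require Import boolp classical_sets functions cardinality reals ereal.
From mathcomp Require Import topology normedtype sequences esum.
From mathcomp Require Import ring lra.

Set Implicit Arguments.
Unset Strict Implicit.
Unset Printing Implicit Defensive.

Import Order.TTheory GRing.Theory Num.Theory.
Import numFieldNormedType.Exports.

Local Open Scope classical_set_scope.
Local Open Scope ring_scope.
Local Open Scope complex_scope.

(** * The real-valued norm and Cauchy-Schwarz for finite sums *)

Section Norm.
Variable R : realType.
Implicit Types V : normedZmodType R[i].

Lemma rnormE V (x : V) : (rnorm x)%:C = `|x|.
Proof. by rewrite /rnorm RRe_real // normr_real. Qed.

Lemma rnorm_ge0 V (x : V) : 0 <= rnorm x.
Proof. by rewrite -ler0c rnormE normr_ge0. Qed.

Lemma rnorm0 V : rnorm (0 : V) = 0.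
Proof. by apply: complexI; rewrite rnormE normr0. Qed.

Lemma rnorm_eq0 V (x : V) : rnorm x = 0 -> x = 0.
Proof. by move=> x0; apply: normr0_eq0; rewrite -rnormE x0. Qed.

Lemma rnormN V (x : V) : rnorm (- x) = rnorm x.
Proof. by rewrite /rnorm normrN. Qed.

Lemma rnormBC V (x y : V) : rnorm (x - y) = rnorm (y - x).
Proof. by rewrite -rnormN opprB. Qed.

Lemma rnormD V (x y : V) : rnorm (x + y) <= rnorm x + rnorm y.
Proof. by rewrite -lecR rmorphD /= !rnormE ler_normD. Qed.

Lemma rnormB V (x y : V) : rnorm (x - y) <= rnorm x + rnorm y.
Proof. by rewrite -(rnormN y) rnormD. Qed.

Lemma rnorm_sum V (I : Type) (r : seq I) (P : pred I) (F : I -> V) :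
  rnorm (\sum_(i <- r | P i) F i) <= \sum_(i <- r | P i) rnorm (F i).
Proof.
elim/big_rec2: _ => [|i y x _ le_xy]; first by rewrite rnorm0.
by rewrite (le_trans (rnormD _ _)) // lerD2l.
Qed.

Lemma rnormM (a b : R[i]) : rnorm (a * b) = rnorm a * rnorm b.
Proof. by apply: complexI; rewrite rmorphM /= !rnormE normrM. Qed.

Lemma rnormZ (V : normedModType R[i]) (a : R[i]) (x : V) :
  rnorm (a *: x) = rnorm a * rnorm x.
Proof. by apply: complexI; rewrite rmorphM /= !rnormE normrZ. Qed.

Lemma rnormC (a : R[i]) : rnorm (Num.conj a) = rnorm a.
Proof. by rewrite /rnorm norm_conjC. Qed.

Lemma rnorm_real (r : R) : rnorm r%:C = `|r|.
Proof. by rewrite /rnorm normc_def /= expr0n addr0 sqrtr_sqr. Qed.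

Lemma Re_le_rnorm (a : R[i]) : complex.Re a <= rnorm a.
Proof.
by rewrite (le_trans (ler_norm _)) // -lecR rnormE normc_ge_Re.
Qed.

Lemma conj_realC (r : R) : Num.conj r%:C = r%:C :> R[i].
Proof. by apply: conj_Creal; rewrite complex_real. Qed.

Lemma mul_conj_rnorm (a : R[i]) : a * Num.conj a = (rnorm a ^+ 2)%:C.
Proof. by rewrite -normCK rmorphXn /= rnormE. Qed.

Lemma rnorm_sqrE (a : R[i]) :
  rnorm a ^+ 2 = complex.Re a ^+ 2 + complex.Im a ^+ 2.
Proof. by apply: complexI; rewrite add_Re2_Im2 -rnormE rmorphXn. Qed.

Lemma rnorm_sqrD (a b : R[i]) : rnorm (a + b) ^+ 2 =
  rnorm a ^+ 2 + rnorm b ^+ 2 + 2 * complex.Re (Num.conj a * b).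
Proof.
by rewrite !rnorm_sqrE; case: a b => [x y] [x' y'] /=; ring.
Qed.

Lemma sumr_CauchySchwarz (I : Type) (r : seq I) (F G : I -> R) :
  (forall i, 0 <= F i) -> (forall i, 0 <= G i) ->
  (\sum_(i <- r) F i * G i) ^+ 2
  <= (\sum_(i <- r) F i ^+ 2) * (\sum_(i <- r) G i ^+ 2).
Proof.
move=> F0 G0; elim: r => [|i r IH]; first by rewrite !big_nil expr0n mul0r.
rewrite !big_cons.
have : 0 <= \sum_(j <- r) F j * G j.
  by apply: sumr_ge0 => j _; rewrite mulr_ge0.
have : 0 <= \sum_(j <- r) F j ^+ 2 by apply: sumr_ge0 => j _; rewrite sqr_ge0.
have : 0 <= \sum_(j <- r) G j ^+ 2 by apply: sumr_ge0 => j _; rewrite sqr_ge0.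
move: IH (F0 i) (G0 i); move: (F i) (G i) => x y.
set p := \sum_(_ <- _) _ * _; set X := \sum_(_ <- _) _ ^+ 2.
set Y := \sum_(_ <- _) _ ^+ 2 => pXY x0 y0 Y0 X0 p0.
suff : 2 * (p * (x * y)) <= X * y ^+ 2 + Y * x ^+ 2 by move=> h; nra.
(* After squaring, p^2 <= X Y reduces the claim to 4 u v <= (u + v)^2 with u = X y^2 and v = Y
   x^2. *)
rewrite -ler_sqr ?nnegrE; last 2 first.
- by rewrite !mulr_ge0.
- by rewrite addr_ge0 ?mulr_ge0 ?sqr_ge0.
have h1 : p ^+ 2 * (x * y) ^+ 2 <= X * Y * (x * y) ^+ 2.
  by rewrite ler_wpM2r ?sqr_ge0.
have h2 := sqr_ge0 (X * y ^+ 2 - Y * x ^+ 2).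
by rewrite -subr_ge0; move: h1 h2; rewrite -subr_ge0 => h1 h2; nra.
Qed.

Lemma rnorm_sumM (I : Type) (r : seq I) (F G : I -> R[i]) :
  rnorm (\sum_(i <- r) F i * G i) ^+ 2
  <= (\sum_(i <- r) rnorm (F i) ^+ 2) * (\sum_(i <- r) rnorm (G i) ^+ 2).
Proof.
apply: le_trans (sumr_CauchySchwarz r _ _) => [|i|i]; try exact: rnorm_ge0.
rewrite ler_sqr ?nnegrE ?rnorm_ge0 ?sumr_ge0 //; last first.
  by move=> i _; rewrite mulr_ge0 ?rnorm_ge0.
by rewrite (le_trans (rnorm_sum _ _ _)) // ler_sum // => i _; rewrite rnormM.
Qed.

Lemma sum_nat_shift (V : nmodType) (F : nat -> V) m n :
  \sum_(m <= k < n) F k = \sum_(0 <= k < n - m) F (k + m)%N.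
Proof. by rewrite -{1}(add0n m) big_addn. Qed.

End Norm.

(* Convergence through the real-valued norm, so that vectors and the scalars
   R[i], which carry no canonical topology, are handled uniformly. *)
Definition rcvg (R : realType) (V : normedZmodType R[i]) (u : nat -> V) (x : V)
  : Prop := (fun n => rnorm (u n - x)) @ \oo --> (0 : R).

(** * Limits, completeness and fixed points of contractions *)

Section Rcvg.
Variable R : realType.
Implicit Types V W : normedZmodType R[i].

Lemma rcvgP V (u : nat -> V) x :
  rcvg u x <-> forall e : R, 0 < e ->
    exists N, forall n, (N <= n)%N -> rnorm (u n - x) < e.
Proof.
split=> [/cvgr0Pnorm_lt ux e /ux [N _ uN]|ux].
  by exists N => n /uN /=; rewrite ger0_norm ?rnorm_ge0.
apply/cvgr0Pnorm_lt => e /ux [N uN]; exists N => // n /uN /=.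
by rewrite ger0_norm ?rnorm_ge0.
Qed.

Lemma rcvg_dom V (u : nat -> V) x (a : nat -> R) :
  a @ \oo --> 0 -> (forall n, rnorm (u n - x) <= a n) -> rcvg u x.
Proof.
move=> a0 ua; apply: (squeeze_cvgr _ (cvg_cst 0) a0).
by apply: nearW => n; rewrite rnorm_ge0 ua.
Qed.

Lemma rcvg_cst V (x : V) : rcvg (fun=> x) x.
Proof.
by apply: (@rcvg_dom _ _ _ (fun=> 0)) => [|n]; [exact: cvg_cst|rewrite /= subrr rnorm0].
Qed.

Lemma rcvg_addn V (u : nat -> V) x N :
  rcvg (fun n => u (n + N)%N) x <-> rcvg u x.
Proof.
split=> /rcvgP ux; apply/rcvgP => e /ux [M uM].
  exists (M + N)%N => n MNn; have Nn := leq_trans (leq_addl _ _) MNn.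
  by rewrite -(subnK Nn) uM // leq_subRL // addnC.
by exists M => n Mn; rewrite uM // (leq_trans Mn) // leq_addr.
Qed.

Lemma rcvg_unique V (u : nat -> V) x y : rcvg u x -> rcvg u y -> x = y.
Proof.
move=> /rcvgP ux /rcvgP uy; apply/eqP; rewrite -subr_eq0; apply/eqP/rnorm_eq0.
apply/eqP; rewrite eq_le rnorm_ge0 andbT leNgt; apply/negP => e0.
have e2 : 0 < rnorm (x - y) / 2 by rewrite divr_gt0.
have [N uN] := ux _ e2; have [M uM] := uy _ e2.
have := uN (maxn N M) (leq_maxl _ _); have := uM (maxn N M) (leq_maxr _ _).
have := rnormB (u (maxn N M) - y) (u (maxn N M) - x).
by rewrite opprB addrC subrKA; lra.
Qed.

Lemma rcvg_lipschitz V W (F : V -> W) (M : R) (u : nat -> V) x :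
  (forall y z, rnorm (F y - F z) <= M * rnorm (y - z)) ->
  rcvg u x -> rcvg (F \o u) (F x).
Proof.
move=> Flip ux.
apply: (@rcvg_dom _ _ _ (fun n => M * rnorm (u n - x))) => [|n]; last exact: Flip.
by rewrite -(mulr0 M); apply: cvgM ux; exact: cvg_cst.
Qed.

Lemma rcvgD V (u v : nat -> V) x y :
  rcvg u x -> rcvg v y -> rcvg (fun n => u n + v n) (x + y).
Proof.
move=> ux vy.
apply: (@rcvg_dom _ _ _ (fun n => rnorm (u n - x) + rnorm (v n - y))).
  by rewrite -(addr0 0); apply: cvgD.
by move=> n; rewrite opprD addrACA rnormD.
Qed.

Lemma rcvgN V (u : nat -> V) x : rcvg u x -> rcvg (fun n => - u n) (- x).
Proof.
by apply: (rcvg_lipschitz (M := 1)) => y z; rewrite -opprD rnormN mul1r.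
Qed.

Lemma rcvgB V (u v : nat -> V) x y :
  rcvg u x -> rcvg v y -> rcvg (fun n => u n - v n) (x - y).
Proof. by move=> ux /rcvgN; exact: rcvgD. Qed.

Lemma rcvgZ (V : normedModType R[i]) (a : R[i]) (u : nat -> V) x :
  rcvg u x -> rcvg (fun n => a *: u n) (a *: x).
Proof.
by apply: (rcvg_lipschitz (M := rnorm a)) => y z; rewrite -scalerBr rnormZ.
Qed.

Lemma rcvgMl (a : R[i]) (u : nat -> R[i]) x :
  rcvg u x -> rcvg (fun n => a * u n) (a * x).
Proof.
by apply: (rcvg_lipschitz (M := rnorm a)) => y z; rewrite -mulrBr rnormM.
Qed.

Lemma rcvgMl0 (a : R[i]) (u : nat -> R[i]) :
  rcvg u 0 -> rcvg (fun n => a * u n) 0.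
Proof. by move=> /(rcvgMl a); rewrite mulr0. Qed.

Lemma rcvgC (u : nat -> R[i]) x :
  rcvg u x -> rcvg (fun n => Num.conj (u n)) (Num.conj x).
Proof.
by apply: (rcvg_lipschitz (M := 1)) => y z; rewrite -rmorphB rnormC mul1r.
Qed.

Lemma rcvg_sum V (I : Type) (r : seq I) (P : pred I) (u : I -> nat -> V)
    (x : I -> V) : (forall i, P i -> rcvg (u i) (x i)) ->
  rcvg (fun n => \sum_(i <- r | P i) u i n) (\sum_(i <- r | P i) x i).
Proof.
move=> ux; elim: r => [|i r IH].
  by rewrite big_nil; under eq_fun do rewrite big_nil; exact: rcvg_cst.
rewrite big_cons; under eq_fun do rewrite big_cons; case: ifP => // Pi.
by apply: rcvgD IH; exact: ux.
Qed.

Lemma rcvg_sum0 V (I : Type) (r : seq I) (P : pred I) (u : I -> nat -> V) :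
  (forall i, P i -> rcvg (u i) 0) ->
  rcvg (fun n => \sum_(i <- r | P i) u i n) 0.
Proof. by move=> /(rcvg_sum r); rewrite [X in rcvg _ X]big1. Qed.

Lemma rcvg_rnorm_le V (u : nat -> V) x (C : R) :
  rcvg u x -> (forall n, rnorm (u n) <= C) -> rnorm x <= C.
Proof.
move=> /rcvgP ux uC; apply/ler_addgt0Pr => e /ux [N /(_ N (leqnn N)) uN].
have := rnormB (u N) (u N - x); rewrite opprB addrCA subrr addr0 => /le_trans.
by apply; rewrite lerD // ltW.
Qed.

Lemma rcvg_Re (u : nat -> R[i]) x :
  rcvg u x -> (fun n => complex.Re (u n)) @ \oo --> complex.Re x.
Proof.
move=> /rcvgP ux; apply/cvgrPdist_lt => e /ux [N uN]; exists N => // n /uN.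
apply: le_lt_trans; rewrite distrC -raddfB -lecR rnormE.
exact: normc_ge_Re.
Qed.

Lemma rcvg_cauchy (H : completeNormedModType R[i]) (u : nat -> H) :
  (forall e : R, 0 < e -> exists N, forall m n, (N <= m)%N -> (N <= n)%N ->
     rnorm (u m - u n) < e) ->
  exists x, rcvg u x.
Proof.
move=> uC; have : cauchy (u @ \oo).
  (* A positive element of [R[i]] has imaginary part 0, so its real part serves as the radius. *)
  apply/cauchy_exP => e; rewrite ltcE => /andP[/eqP Ime Ree].
  have [N uN] := uC _ Ree; exists (u N), N => // n Nn.
  rewrite -ball_normE /ball_ /= -rnormE ltcE Ime eqxx /=.
  by apply: uN => //=.
move=> /cauchy_cvgP /cvg_ex [x /cvgrPdist_lt ux]; exists x; apply/rcvgP => e e0.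
have [|N _ uN] := ux e%:C; first by rewrite ltcR.
by exists N => n /uN /=; rewrite -rnormE ltcR rnormBC.
Qed.

Lemma cvg_geometric0 (C q : R) :
  0 <= q -> q < 1 -> (fun n => C * q ^+ n) @ \oo --> (0 : R).
Proof. by move=> q0 q1; apply: cvg_geometric; rewrite ger0_norm. Qed.

Lemma geometric_rcvg (H : completeNormedModType R[i]) (u : nat -> H) (C q : R) :
  0 <= q -> q < 1 -> (forall n, rnorm (u n.+1 - u n) <= C * q ^+ n) ->
  exists2 x, rcvg u x & forall n, rnorm (x - u n) <= C / (1 - q) * q ^+ n.
Proof.
move=> q0 q1 uq; have q1' : 0 < 1 - q by rewrite subr_gt0.
have C0 : 0 <= C by have := le_trans (rnorm_ge0 _) (uq 0%N); rewrite mulr1.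
have D0 : 0 <= C / (1 - q) by rewrite divr_ge0 // ltW.
have dist n m : rnorm (u (n + m)%N - u n) <= C / (1 - q) * q ^+ n.
  (* Keeping the subtracted term [q ^+ (n + m)] makes the induction on [m] close with equality in
     the geometric sum. *)
  suff : rnorm (u (n + m)%N - u n) <= C / (1 - q) * (q ^+ n - q ^+ (n + m)).
    move=> /le_trans; apply; rewrite ler_wpM2l // gerBl exprn_ge0 //.
  elim: m => [|m IH]; first by rewrite addn0 !subrr rnorm0 mulr0.
  rewrite addnS -(subrKA (u (n + m)%N)) (le_trans (rnormD _ _)) //.
  rewrite (le_trans (lerD (uq _) IH)) // le_eqVlt; apply/orP; left; apply/eqP.
  rewrite exprS; field; exact: lt0r_neq0.
have [|x ux] := @rcvg_cauchy H u.
  move=> e e0; have /cvgr0Pnorm_lt := cvg_geometric0 (C / (1 - q)) q0 q1.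
  have e2 : 0 < e / 2 by rewrite divr_gt0.
  move=> /(_ _ e2)[N _ /(_ N (leqnn N)) /= lt_e].
  have {}lt_e := le_lt_trans (ler_norm _) lt_e.
  exists N => m n Nm Nn; rewrite -(subnKC Nm) -(subnKC Nn).
  have := dist N (m - N)%N; have := dist N (n - N)%N.
  have := rnormB (u (N + (m - N))%N - u N) (u (N + (n - N))%N - u N).
  by rewrite opprB subrKA; lra.
exists x => // n; rewrite rnormBC.
apply: (@rcvg_rnorm_le _ (fun m => u n - u (n + m)%N)) => [|m]; last first.
  by rewrite rnormBC.
apply: rcvgB; first exact: rcvg_cst.
by under eq_fun do rewrite addnC; exact/rcvg_addn.
Qed.

(** Banach iteration started at 0; it serves to invert the frame operator. *)
Lemma contraction_fixpoint (H : completeNormedModType R[i]) (G : H -> H) (q : R) :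
  0 <= q -> q < 1 -> (forall x y, rnorm (G x - G y) <= q * rnorm (x - y)) ->
  exists x, G x = x.
Proof.
move=> q0 q1 Gq; pose u n := iter n G 0.
have [|x ux _] := @geometric_rcvg H u (rnorm (G 0)) q q0 q1.
  elim=> [|n IH]; first by rewrite /u /= subr0 expr0 mulr1.
  by rewrite (le_trans (Gq _ _)) // exprS mulrCA ler_wpM2l.
exists x; apply: (@rcvg_unique _ (fun n => u (n + 1)%N)); last exact/rcvg_addn.
under eq_fun do rewrite addn1.
exact: rcvg_lipschitz Gq ux.
Qed.

End Rcvg.

(** * Inner product *)

Section InnerProduct.
Variables (R : realType) (H : completeNormedModType R[i]).
Variable dot : {dot H for @Num.conj R[i]}.
Hypothesis dot_norm : forall x : H, dot x x = `|x| ^+ 2.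
Implicit Types (x y : H) (a : R[i]).

Lemma dotC x y : dot y x = Num.conj (dot x y).
Proof. by rewrite hermC expr0 mul1r. Qed.

Lemma dotDr x y z : dot x (y + z) = dot x y + dot x z.
Proof. exact: linearDr. Qed.

Lemma dotNr x y : dot x (- y) = - dot x y.
Proof. exact: linearNr. Qed.

Lemma dotBr x y z : dot x (y - z) = dot x y - dot x z.
Proof. by rewrite dotDr dotNr. Qed.

Lemma dotZr x a y : dot x (a *: y) = Num.conj a * dot x y.
Proof. exact: linearZr_LR. Qed.

Lemma dotr0 x : dot x 0 = 0.
Proof. exact: linear0r. Qed.

Lemma dotBl x y z : dot (x - y) z = dot x z - dot y z.
Proof. by rewrite dotC dotBr rmorphB /= -!dotC. Qed.

Lemma dotZl x a y : dot (a *: x) y = a * dot x y.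
Proof. by rewrite dotC dotZr rmorphM /= conjCK -dotC. Qed.

Lemma dot_sumr x (I : Type) (r : seq I) (P : pred I) (F : I -> H) :
  dot x (\sum_(i <- r | P i) F i) = \sum_(i <- r | P i) dot x (F i).
Proof.
by elim/big_rec2: _ => [|i y z _ <-]; rewrite ?dotr0 // dotDr.
Qed.

Lemma dot_suml x (I : Type) (r : seq I) (P : pred I) (F : I -> H) :
  dot (\sum_(i <- r | P i) F i) x = \sum_(i <- r | P i) dot (F i) x.
Proof. by rewrite dotC dot_sumr rmorph_sum /=; under eq_bigr do rewrite -dotC. Qed.

Lemma dotxx x : dot x x = (rnorm x ^+ 2)%:C.
Proof. by rewrite dot_norm -rnormE rmorphXn. Qed.

Lemma Re_dotC x y : complex.Re (dot y x) = complex.Re (dot x y).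
Proof. by rewrite dotC; case: (dot x y). Qed.

Lemma rnorm_dotC x y : rnorm (dot y x) = rnorm (dot x y).
Proof. by rewrite dotC rnormC. Qed.

Lemma rnorm_sqrB x y :
  rnorm (x - y) ^+ 2 = rnorm x ^+ 2 + rnorm y ^+ 2 - 2 * complex.Re (dot x y).
Proof.
have := congr1 (@complex.Re R) (dotxx (x - y)); rewrite /= => <-.
rewrite dotBr !dotBl !raddfB /= !dotxx /= (Re_dotC x y).
by ring.
Qed.

Lemma dot_CauchySchwarz x y : rnorm (dot x y) <= rnorm x * rnorm y.
Proof.
have [y0|y0] := eqVneq y 0.
  by rewrite y0 dotr0 !rnorm0 mulr0.
have ny0 : 0 < rnorm y.
  rewrite lt_neqAle rnorm_ge0 andbT eq_sym; apply: contra_neq y0.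
  exact: rnorm_eq0.
(* [t *: y] is the orthogonal projection of [x] onto the line of [y]; the inequality is |x - t y|^2
   >= 0. *)
pose t := dot x y * ((rnorm y ^+ 2)^-1)%:C.
have := sqr_ge0 (rnorm (x - t *: y)).
rewrite rnorm_sqrB dotZr rnormZ.
have -> : Num.conj t * dot x y = (rnorm (dot x y) ^+ 2 / rnorm y ^+ 2)%:C.
  rewrite /t [Num.conj _]rmorphM /= conj_realC mulrAC [_ * dot x y]mulrC.
  by rewrite mul_conj_rnorm -rmorphM.
have -> : rnorm t = rnorm (dot x y) / rnorm y ^+ 2.
  by rewrite rnormM rnorm_real ger0_norm // invr_ge0 sqr_ge0.
rewrite /= => h; rewrite -ler_sqr ?nnegrE ?mulr_ge0 ?rnorm_ge0 //.
rewrite exprMn -ler_pdivrMr ?exprn_gt0 //.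
suff : rnorm (dot x y) ^+ 2 / rnorm y ^+ 2 =
    2 * (rnorm (dot x y) ^+ 2 / rnorm y ^+ 2)
    - (rnorm (dot x y) / rnorm y ^+ 2 * rnorm y) ^+ 2 by lra.
by field; rewrite lt0r_neq0.
Qed.

Lemma rcvg_dotr z (u : nat -> H) x :
  rcvg u x -> rcvg (fun n => dot z (u n)) (dot z x).
Proof.
apply: (rcvg_lipschitz (M := rnorm z)) => y y'.
by rewrite -dotBr dot_CauchySchwarz.
Qed.

Lemma rcvg_dotl z (u : nat -> H) x :
  rcvg u x -> rcvg (fun n => dot (u n) z) (dot x z).
Proof.
move=> /(rcvg_dotr z) /rcvgC; rewrite -dotC.
by under eq_fun do rewrite -dotC.
Qed.

Lemma dot_eq0 x : (forall g, dot g x = 0) -> x = 0.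
Proof.
move=> /(_ x); rewrite dotxx => /(congr1 (@complex.Re R)) /= /eqP.
by rewrite expf_eq0 /= => /eqP /rnorm_eq0.
Qed.

(* Sokal's gliding hump, which needs neither Baire nor scalars in R. *)
Lemma weakly_bounded_bounded (G : set H) :
  (forall x, exists M : R, forall g, G g -> rnorm (dot g x) <= M) ->
  exists M : R, forall g, G g -> rnorm g <= M.
Proof.
move=> Gx; apply: contrapT => unb.
have /choice[g gP] : forall n : nat, exists g, G g /\ 4 ^+ n <= rnorm g :> R.
  move=> n; apply: contrapT => ng; apply: unb; exists (4 ^+ n) => g Gg.
  by rewrite leNgt; apply/negP => /ltW lt_g; apply: ng; exists g.
have ng0 n : 0 < rnorm (g n).
  by have [_ /lt_le_trans] := gP n; apply; rewrite exprn_gt0.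
(* Steps of length 3^-n are summable, yet against norms of at least 4^n they produce values growing
   like (4/3)^n. *)
pose q : R := 3^-1; have q0 : 0 <= q by rewrite invr_ge0.
pose e n := (q ^+ n / rnorm (g n))%:C *: g n.
have ne n : rnorm (e n) = q ^+ n.
  rewrite /e rnormZ rnorm_real ger0_norm ?divfK ?lt0r_neq0 //.
  by rewrite divr_ge0 ?exprn_ge0 ?rnorm_ge0.
have dge n : rnorm (dot (g n) (e n)) = q ^+ n * rnorm (g n).
  have h : 0 <= q ^+ n / rnorm (g n) by rewrite divr_ge0 ?exprn_ge0 ?rnorm_ge0.
  rewrite /e dotZr dotxx rnormM rnormC !rnorm_real !ger0_norm ?sqr_ge0 //.
  by rewrite expr2 mulrA divfK // lt0r_neq0.
(* The values of [dot (g n)] at [x + e n] and [x - e n] differ by [2 * dot (g n) (e n)], so one of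
   them is large enough. *)
have step n x : exists y, rnorm (y - x) = q ^+ n /\
    q ^+ n * rnorm (g n) <= rnorm (dot (g n) y).
  have [h|h] := lerP (q ^+ n * rnorm (g n)) (rnorm (dot (g n) (x + e n))).
    by exists (x + e n); rewrite addrAC subrr add0r ne.
  exists (x - e n); rewrite addrAC subrr add0r rnormN ne; split=> //.
  have := rnormB (dot (g n) (x + e n)) (dot (g n) (x - e n)).
  have -> : dot (g n) (x + e n) - dot (g n) (x - e n) = 2 * dot (g n) (e n).
    by rewrite dotBr dotDr; ring.
  by rewrite rnormM -(rmorph_nat (real_complex R)) rnorm_real ger0_norm // dge; lra.
have /choice[s sP] : forall nx : nat * H, exists y,
    rnorm (y - nx.2) = q ^+ nx.1 /\ q ^+ nx.1 * rnorm (g nx.1) <= rnorm (dot (g nx.1) y).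
  by move=> [n x]; exact: step.
pose u := fix u n : H := if n is m.+1 then s (m, u m) else 0.
have uP n := sP (n, u n).
have q1 : q < 1 by rewrite invf_lt1 // ltr1n.
have du n : rnorm (u n.+1 - u n) <= 1 * q ^+ n.
  by rewrite mul1r le_eqVlt (proj1 (uP n)) eqxx.
have [x ux distx] := geometric_rcvg q0 q1 du.
have [M Mx] := Gx x.
(* All steps after the n-th move the point by at most q^n / 2 in total, which costs at most half of
   the value q^n |g n| gained at that step. *)
have low n : 2^-1 * (4 / 3) ^+ n <= rnorm (dot (g n) x).
  have h1 := proj2 (uP n); rewrite /= -[s _]/(u n.+1) in h1.
  have h2 := dot_CauchySchwarz (g n) (x - u n.+1).
  have h3 := distx n.+1; have h4 := proj2 (gP n).
  have -> : dot (g n) x = dot (g n) (u n.+1) + dot (g n) (x - u n.+1).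
    by rewrite dotBr; ring.
  have := rnormB (dot (g n) (u n.+1) + dot (g n) (x - u n.+1)) (dot (g n) (x - u n.+1)).
  rewrite addrK => h5.
  have h6 : rnorm (g n) * rnorm (x - u n.+1) <= rnorm (g n) * (2^-1 * q ^+ n).
    rewrite ler_wpM2l ?rnorm_ge0 // (le_trans h3) // exprS /q.
    by rewrite le_eqVlt; apply/orP; left; apply/eqP; field.
  have h7 : (4 / 3) ^+ n <= q ^+ n * rnorm (g n).
    by rewrite exprMn mulrC ler_wpM2l // exprn_ge0.
  lra.
have [N lt_N] : exists N, M < 2^-1 * (4 / 3) ^+ N :> R.
  have r0 : 0 <= 3 / 4 :> R by lra.
  have r1 : 3 / 4 < 1 :> R by lra.
  have /cvgr0Pnorm_lt/(_ 1 ltr01) := cvg_geometric0 (2 * M) r0 r1.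
  move=> [N _ /(_ N (leqnn N)) /=] /(le_lt_trans (ler_norm _)) lt1.
  exists N; rewrite -ltr_pdivrMr; last by rewrite exprn_gt0; lra.
  by rewrite -exprVn invf_div; lra.
have := low N; have [GgN _] := gP N.
have := Mx _ GgN; lra.
Qed.

End InnerProduct.

(** * Square-summable sequences and frames *)

Definition sqsum_le (R : realType) (c : nat -> R[i]) (M : R) : Prop :=
  forall n, \sum_(0 <= k < n) rnorm (c k) ^+ 2 <= M.

Section SquareSummable.
Variable R : realType.
Implicit Types (c : nat -> R[i]) (M : R).

Lemma sqsum_ge0 c M : sqsum_le c M -> 0 <= M.
Proof. by move=> /(_ 0%N); rewrite big_nil. Qed.

Lemma sqsum_tail_le c M m n : sqsum_le c M ->
  \sum_(m <= k < n) rnorm (c k) ^+ 2 <= M.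
Proof.
move=> cM; have [mn|nm] := leqP m n; last first.
  by rewrite big_geq ?(sqsum_ge0 cM) // ltnW.
apply: le_trans (cM n); rewrite (big_cat_nat (leq0n m) mn) /= lerDr.
by apply: sumr_ge0 => k _; rewrite sqr_ge0.
Qed.

Lemma sqsum_addn c M m : sqsum_le c M -> sqsum_le (fun n => c (n + m)%N) M.
Proof.
move=> cM n; rewrite -[n in leLHS](addnK m).
rewrite -(sum_nat_shift (fun k => rnorm (c k) ^+ 2)).
exact: sqsum_tail_le.
Qed.

(** The partial sums increase to their supremum; once one of them is within [e] of it, every later
    block is below [e]. *)
Lemma sqsum_tail_small c M (e : R) : sqsum_le c M -> 0 < e ->
  exists N, forall m n, (N <= m)%N -> \sum_(m <= k < n) rnorm (c k) ^+ 2 < e.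
Proof.
move=> cM e0; pose S := range (fun n => \sum_(0 <= k < n) rnorm (c k) ^+ 2).
have S0 : S !=set0 by exists (\sum_(0 <= k < 0) rnorm (c k) ^+ 2); exists 0%N.
have ubS : has_ubound S by exists M => _ [n _ <-].
have [_ [N _ <-] ltN] := sup_adherent e0 (conj S0 ubS).
exists N => m n Nm; have [mn|nm] := leqP m n; last by rewrite big_geq // ltnW.
have : \sum_(0 <= k < n) rnorm (c k) ^+ 2 <= sup S.
  by apply: ub_le_sup => //; exists n.
rewrite (big_cat_nat (leq0n m) mn) (big_cat_nat (leq0n N) Nm) /=.
have : 0 <= \sum_(N <= k < m) rnorm (c k) ^+ 2.
  by apply: sumr_ge0 => k _; rewrite sqr_ge0.
move: ltN; lra.
Qed.

Lemma sqr_rnormD (a b : R[i]) :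
  rnorm (a + b) ^+ 2 <= 2 * rnorm a ^+ 2 + 2 * rnorm b ^+ 2.
Proof.
have h := rnormD a b; have h0 := rnorm_ge0 (a + b).
have : rnorm (a + b) ^+ 2 <= (rnorm a + rnorm b) ^+ 2.
  by rewrite ler_sqr ?nnegrE ?addr_ge0 ?rnorm_ge0.
have := sqr_ge0 (rnorm a - rnorm b); nra.
Qed.

Lemma sqsumD c M c' M' : sqsum_le c M -> sqsum_le c' M' ->
  sqsum_le (fun k => c k + c' k) (2 * M + 2 * M').
Proof.
move=> cM cM' n; have := cM n; have := cM' n.
have : \sum_(0 <= k < n) rnorm (c k + c' k) ^+ 2 <=
   2 * \sum_(0 <= k < n) rnorm (c k) ^+ 2 + 2 * \sum_(0 <= k < n) rnorm (c' k) ^+ 2.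
  rewrite !mulr_sumr -big_split /=; apply: ler_sum => k _; exact: sqr_rnormD.
lra.
Qed.

Lemma sqsumZ a c M : sqsum_le c M ->
  sqsum_le (fun k => a * c k) (rnorm a ^+ 2 * M).
Proof.
move=> cM n; under eq_bigr do rewrite rnormM exprMn.
by rewrite -mulr_sumr ler_wpM2l ?sqr_ge0.
Qed.

Lemma sqsumN c M : sqsum_le c M -> sqsum_le (fun k => - c k) M.
Proof. by move=> cM n; under eq_bigr do rewrite rnormN. Qed.

End SquareSummable.

Section Frames.
Variables (R : realType) (H : completeNormedModType R[i]).
Variable dot : {dot H for @Num.conj R[i]}.
Hypothesis dot_norm : forall x : H, dot x x = `|x| ^+ 2.
Implicit Types (f : nat -> H) (c : nat -> R[i]) (x y g : H) (A B M : R).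

(** The graph of the synthesis operator U_f, a relation because the series need not converge for
    arbitrary [f] and [c]. *)
Definition synthesis f c x : Prop :=
  rcvg (fun n => \sum_(0 <= k < n) c k *: f k) x.

Definition bessel f B : Prop :=
  0 < B /\ forall g, sqsum_le (fun k => dot g (f k)) (B * rnorm g ^+ 2).

(** Ranging over all bounds [M] of the partial sums states the lower inequality for their
    supremum. *)
Definition frame_bounds f A B : Prop :=
  [/\ 0 < A, bessel f B & forall g M,
     sqsum_le (fun k => dot g (f k)) M -> A * rnorm g ^+ 2 <= M].

Lemma esum_nat_le (a : nat -> R) (M : R) : (forall n, 0 <= a n) ->
  (\esum_(k in [set: nat]) (a k)%:E <= M%:E)%E <->
  forall n, \sum_(0 <= k < n) a k <= M.
Proof.
move=> a0; have a0' k : (0 <= (a k)%:E)%E by rewrite lee_fin.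
rewrite -nneseries_esumT //; split=> [le_aM n|le_aM].
  rewrite -lee_fin -sumEFin; apply: le_trans le_aM.
  exact: nneseries_lim_ge.
apply: lime_le; first exact: is_cvg_nneseries.
by apply: nearW => n; rewrite sumEFin lee_fin.
Qed.

Lemma esum_nat_ge (a : nat -> R) (A : R) : (forall n, 0 <= a n) ->
  (A%:E <= \esum_(k in [set: nat]) (a k)%:E)%E <->
  forall M, (forall n, \sum_(0 <= k < n) a k <= M) -> A <= M.
Proof.
move=> a0; split=> [leA M /esum_nat_le aM|leA].
  by rewrite -lee_fin (le_trans leA) // aM.
have : (0 <= \esum_(k in [set: nat]) (a k)%:E)%E.
  by apply: esum_ge0 => k _; rewrite lee_fin.
case E : (esum _ _) => [s| |] // _; last by rewrite leey.
by rewrite lee_fin; apply: leA; apply/esum_nat_le => //; rewrite E.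
Qed.

Lemma frameP f : frame dot f <-> exists A B, frame_bounds f A B.
Proof.
have a0 g k : 0 <= rnorm (dot g (f k)) ^+ 2 by rewrite sqr_ge0.
split=> -[A [B]].
  move=> [A0 B0 fAB]; exists A, B; split=> // [|g M gM].
    split=> // g; by apply/esum_nat_le => //; have [] := fAB g.
  by have [/esum_nat_ge + _] := fAB g; apply.
move=> [A0 [B0 fB] fA]; exists A, B; split=> // g; split.
  by apply/esum_nat_ge => // M; exact: fA.
by apply/esum_nat_le => //; exact: fB.
Qed.

Lemma synthesis_unique f c x y : synthesis f c x -> synthesis f c y -> x = y.
Proof. exact: rcvg_unique. Qed.

Lemma synthesisB f c c' x y : synthesis f c x -> synthesis f c' y ->
  synthesis f (fun k => c k - c' k) (x - y).
Proof.
move=> /rcvgB /[apply]; rewrite /synthesis.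
by under eq_fun do rewrite -sumrB; under eq_fun do under eq_bigr do rewrite -scalerBl.
Qed.

Lemma synthesisD f c c' x y : synthesis f c x -> synthesis f c' y ->
  synthesis f (fun k => c k + c' k) (x + y).
Proof.
move=> /rcvgD /[apply]; rewrite /synthesis.
by under eq_fun do rewrite -big_split /=; under eq_fun do under eq_bigr do rewrite -scalerDl.
Qed.

Lemma synthesisZ f a c x : synthesis f c x ->
  synthesis f (fun k => a * c k) (a *: x).
Proof.
move=> /(rcvgZ a); rewrite /synthesis.
by under eq_fun do rewrite scaler_sumr; under eq_fun do under eq_bigr do rewrite scalerA.
Qed.

Lemma synthesis_image f c x (T : {linear H -> H}) : bounded_operators T ->
  synthesis f c x -> synthesis (T \o f) c (T x).
Proof.
move=> [M TM] fc; have := rcvg_lipschitz (F := T) (M := M) _ fc.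
rewrite /synthesis; have -> : T \o (fun n => \sum_(0 <= k < n) c k *: f k) =
    fun n => \sum_(0 <= k < n) c k *: (T \o f) k.
  by apply/funext => n /=; rewrite linear_sum; apply: eq_bigr => k _; rewrite /= linearZ.
by apply => y z; rewrite -raddfB TM.
Qed.

Lemma dot_synthesis f c x g : synthesis f c x ->
  rcvg (fun n => \sum_(0 <= k < n) Num.conj (c k) * dot g (f k)) (dot g x).
Proof.
move=> /(rcvg_dotr dot_norm g).
by under eq_fun do rewrite dot_sumr; under eq_fun do under eq_bigr do rewrite dotZr.
Qed.

(** Duality: with x the sum, |x|^2 = <x, x> is a combination of the coefficients <x, f_k>, so
    Cauchy-Schwarz and the Bessel bound give |x|^4 <= E B |x|^2. *)
Lemma bessel_sum f B c m n : bessel f B ->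
  rnorm (\sum_(m <= k < n) c k *: f k) ^+ 2
  <= B * \sum_(m <= k < n) rnorm (c k) ^+ 2.
Proof.
move=> [B0 fB]; set x := \sum_(m <= k < n) _; set E := \sum_(m <= k < n) _.
have E0 : 0 <= E by apply: sumr_ge0 => k _; rewrite sqr_ge0.
have h : (rnorm x ^+ 2) ^+ 2 <= E * (B * rnorm x ^+ 2).
  have e : rnorm x ^+ 2 = rnorm (\sum_(m <= k < n) Num.conj (c k) * dot x (f k)).
    under eq_bigr do rewrite -dotZr.
    by rewrite -dot_sumr dotxx // rnorm_real ger0_norm ?sqr_ge0.
  have -> : E = \sum_(m <= k < n) rnorm (Num.conj (c k)) ^+ 2.
    by apply: eq_bigr => k _; rewrite rnormC.
  rewrite {1}e (le_trans (rnorm_sumM _ _ _)) // ler_wpM2l ?sumr_ge0 // => [k _|].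
    exact: sqr_ge0.
  exact: sqsum_tail_le.
have [x0|x0] := eqVneq (rnorm x ^+ 2) 0; first by rewrite x0 mulr_ge0 // ltW.
have xp : 0 < rnorm x ^+ 2 by rewrite lt_neqAle eq_sym x0 sqr_ge0.
by move: h; rewrite expr2 mulrA ler_pM2r // mulrC.
Qed.

Lemma synthesis_exists f B c M : bessel f B -> sqsum_le c M ->
  exists2 x, synthesis f c x & rnorm x ^+ 2 <= B * M.
Proof.
move=> fB cM; have B0 := proj1 fB; have M0 := sqsum_ge0 cM.
have [|x fx] := @rcvg_cauchy _ H (fun n => \sum_(0 <= k < n) c k *: f k).
  move=> e e0; have [|N cN] := @sqsum_tail_small _ _ _ (e ^+ 2 / B) cM.
    by rewrite divr_gt0 // exprn_gt0.
  have small m n : (N <= m)%N -> (m <= n)%N ->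
      rnorm (\sum_(0 <= k < n) c k *: f k - \sum_(0 <= k < m) c k *: f k) < e.
    move=> Nm mn; rewrite (big_cat_nat (leq0n m) mn) /= addrAC subrr add0r.
    rewrite -ltr_sqr ?nnegrE ?rnorm_ge0 ?(ltW e0) //.
    by rewrite (le_lt_trans (bessel_sum _ _ _ fB)) // -ltr_pdivlMl // mulrC cN.
  exists N => m n Nm Nn; have [mn|nm] := leqP m n; last exact/small/ltnW.
  by rewrite rnormBC small.
exists x => //; rewrite -(sqr_sqrtr (mulr_ge0 (ltW B0) M0)).
rewrite ler_sqr ?nnegrE ?rnorm_ge0 ?sqrtr_ge0 //.
apply: rcvg_rnorm_le fx _ => n.
rewrite -(ger0_norm (rnorm_ge0 _)) -sqrtr_sqr ler_wsqrtr //.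
by rewrite (le_trans (bessel_sum _ _ _ fB)) // ler_wpM2l // ltW.
Qed.

(** Here [s] is the frame operator applied to [z]: the partial sums of |<z, f_k>|^2 increase to <z,
    s>. *)
Lemma frame_operator_energy f z s : synthesis f (fun k => dot z (f k)) s ->
  sqsum_le (fun k => dot z (f k)) (complex.Re (dot z s)).
Proof.
move=> /(dot_synthesis z) /rcvg_Re.
under eq_fun do under eq_bigr do rewrite mulrC mul_conj_rnorm.
under eq_fun do rewrite -rmorph_sum /=.
move=> zs n; rewrite -(cvg_lim (@Rhausdorff R) zs).
apply: nondecreasing_cvgn_le; last by apply/cvg_ex; eexists; exact: zs.
by apply/nondecreasing_seqP => k; rewrite big_nat_recr //= lerDl sqr_ge0.
Qed.

(** Inverts the frame operator S by the fixed point of z - (S z - x) / B. This map is a contraction: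
    for s = S u, |s|^2 <= B <u, s> and A |u|^2 <= <u, s> give |u - s / B|^2 <= (1 - A / B) |u|^2. *)
Lemma canonical_dual f A B x : frame_bounds f A B -> exists y,
  synthesis f (fun k => dot y (f k)) x /\
  sqsum_le (fun k => dot y (f k)) (rnorm x ^+ 2 / A).
Proof.
move=> [A0 fB fA]; have [B0 fB'] := fB.
have /choice[S SP] z : exists s, synthesis f (fun k => dot z (f k)) s.
  by have [s ? _] := synthesis_exists fB (fB' z); exists s.
pose q := Num.sqrt (1 - A / B); pose t : R[i] := (B^-1)%:C.
have q1 : q < 1 by rewrite -[X in _ < X]sqrtr1 ltr_sqrt // gtrBl divr_gt0.
(* Only an inequality, since [Num.sqrt] is 0 on negative numbers and [A <= B] is not assumed. *)
have qq : 1 - A / B <= q ^+ 2.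
  have [h|h] := lerP 0 (1 - A / B); first by rewrite sqr_sqrtr.
  by rewrite (le_trans (ltW h)) ?sqr_ge0.
have [|y yE] := @contraction_fixpoint _ H (fun z => z - t *: (S z - x)) q (sqrtr_ge0 _) q1.
  move=> z z'; set u := z - z'; pose s := S z - S z'.
  have -> : z - t *: (S z - x) - (z' - t *: (S z' - x)) = u - t *: s.
    by rewrite opprD addrACA -opprD -scalerBr opprB subrKA.
  have us : synthesis f (fun k => dot u (f k)) s.
    have := synthesisB (SP z) (SP z'); congr synthesis.
    by apply/funext => k; rewrite dotBl.
  have ue := frame_operator_energy us; have uA := fA _ _ ue.
  have [s' us' sB] := synthesis_exists fB ue.
  rewrite -(synthesis_unique us us') {s' us'} in sB.
  rewrite -ler_sqr ?nnegrE ?mulr_ge0 ?rnorm_ge0 ?sqrtr_ge0 // exprMn.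
  rewrite (rnorm_sqrB dot_norm) dotZr conj_realC rnormZ rnorm_real ger0_norm; last first.
    by rewrite invr_ge0 ltW.
  have -> : complex.Re (t * dot u s) = B^-1 * complex.Re (dot u s).
    by case: (dot u s) => a b /=; rewrite mul0r subr0.
  rewrite exprMn; set e := complex.Re _ in uA sB *.
  have h1 : B^-1 ^+ 2 * rnorm s ^+ 2 <= B^-1 * e.
    by rewrite expr2 -mulrA ler_pM2l ?invr_gt0 // ler_pdivrMl.
  have h2 : A / B * rnorm u ^+ 2 <= B^-1 * e.
    by rewrite mulrAC mulrC ler_pM2l ?invr_gt0.
  have h3 : (1 - A / B) * rnorm u ^+ 2 <= q ^+ 2 * rnorm u ^+ 2.
    by rewrite ler_wpM2r ?sqr_ge0.
  move: h3; rewrite mulrBl mul1r; lra.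
have {}yE : S y = x.
  have /eqP := yE; rewrite -subr_eq0 addrAC subrr add0r oppr_eq0 scaler_eq0.
  by rewrite subr_eq0 => /orP[/eqP []/eqP|/eqP //]; rewrite invr_eq0 gt_eqF.
exists y; have yx := SP y; rewrite yE in yx; split=> //.
(* The energy e = <y, x> satisfies A |y|^2 <= e <= |y| |x|, hence |y| <= |x| / A and e <= |x|^2 /
   A. *)
have ye := frame_operator_energy yx; have yA := fA _ _ ye.
have := le_trans (Re_le_rnorm _) (dot_CauchySchwarz dot_norm y x).
move: yA ye; set e := complex.Re _ => yA ye ele n.
apply: le_trans (ye n) _; rewrite ler_pdivlMr //.
have := rnorm_ge0 x; have := rnorm_ge0 y; move: (rnorm x) (rnorm y) yA ele => X Y.
have [Y0|Y0] := eqVneq Y 0.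
  by rewrite Y0 mul0r => _ e0 _ X0; rewrite (le_trans (mulr_le0_ge0 e0 (ltW A0))) ?sqr_ge0.
move=> AY eYX Y1 X0; have Yp : 0 < Y by rewrite lt_neqAle eq_sym Y0.
have AYX : A * Y <= X.
  by rewrite -(ler_pM2r Yp) -mulrA -expr2 (le_trans AY) // mulrC.
nra.
Qed.

End Frames.

(** * Convolution by a wandering sequence *)

Section Wandering.
Variable R : realType.
Implicit Types (w a b : nat -> R[i]).

(** Orthogonality of [w] to each of its proper shifts, as limits of partial sums; [j.+1] excludes
    the shift by 0. *)
Definition wandering w : Prop := forall j,
  rcvg (fun n => \sum_(0 <= k < n) Num.conj (w k) * w (k + j.+1)%N) 0.

(** The power S^i of the right shift. *)
Definition delay (i : nat) a : nat -> R[i] :=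
  fun m => if (i <= m)%N then a (m - i)%N else 0.

Lemma delayD i a m : delay i a (m + i) = a m.
Proof. by rewrite /delay leq_addl addnK. Qed.

Lemma delay_lt i a m : (m < i)%N -> delay i a m = 0.
Proof. by rewrite ltnNge /delay => /negPf ->. Qed.

Lemma sqsum_delay i a M : sqsum_le a M -> sqsum_le (delay i a) M.
Proof.
move=> aM n; have [ni|i_n] := leqP n i.
  rewrite big_nat big1 ?(sqsum_ge0 aM) // => k /andP[_ kn].
  by rewrite delay_lt ?rnorm0 ?expr0n // (leq_trans kn).
rewrite (big_cat_nat (leq0n i) (ltnW i_n)) /= big_nat big1 ?add0r; last first.
  by move=> k /andP[_ ki]; rewrite delay_lt ?rnorm0 ?expr0n.
rewrite sum_nat_shift; under eq_bigr do rewrite delayD.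
exact: aM.
Qed.

Lemma delay_gram w (i i' : nat) : wandering w -> (i < i')%N ->
  rcvg (fun n => \sum_(0 <= m < n) Num.conj (delay i' w m) * delay i w m) 0.
Proof.
move=> ww ii'; apply/(rcvg_addn _ _ i').
(* The entries before place [i'] vanish and the rest is the wandering sum for the gap [i' - i]; the
   predecessor compensates the [j.+1] in [wandering]. *)
have := ww (i' - i).-1; congr rcvg; apply/funext => n.
rewrite [RHS](big_cat_nat (leq0n i') (leq_addl n i')) /=.
rewrite [X in _ = X + _]big_nat [X in _ = X + _]big1 ?add0r; last first.
  by move=> m /andP[_ mi]; rewrite delay_lt // rmorph0 mul0r.
rewrite [RHS]sum_nat_shift addnK; apply: eq_bigr => k _.
rewrite delayD prednK ?subn_gt0 // /delay.
by rewrite addnBA ?(ltnW ii') // ifT // (leq_trans (ltnW ii')) // leq_addl.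
Qed.

Lemma delay_gramN w (i i' : nat) : wandering w -> i' != i ->
  rcvg (fun n => \sum_(0 <= m < n) Num.conj (delay i' w m) * delay i w m) 0.
Proof.
move=> ww; rewrite neq_ltn => /orP[ii'|]; last exact: delay_gram.
have /rcvgC := delay_gram ww ii'; rewrite rmorph0; congr rcvg; apply/funext => n.
rewrite rmorph_sum; apply: eq_bigr => k _.
by rewrite rmorphM /= conjCK mulrC.
Qed.

(* Translates of a wandering sequence are orthogonal with norms at most W,
   so convolution by w is bounded by W on square-summable sequences. *)
Lemma wandering_convolution w W b N : wandering w -> sqsum_le w W ->
  \sum_(0 <= j < N) rnorm (\sum_(0 <= i < j.+1) w (j - i)%N * b i) ^+ 2
  <= W * \sum_(0 <= i < N) rnorm (b i) ^+ 2.
Proof.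
move=> ww wW.
pose z m := \sum_(i < N) delay i w m * b i.
pose G (i i' : 'I_N) n :=
  \sum_(0 <= m < n) Num.conj (delay i' w m) * delay i w m.
(* The off-diagonal part of the expanded energy of [z]; it vanishes only in the limit, hence the
   slack [e] below. *)
pose off n := \sum_(i < N) \sum_(i' < N | i' != i)
  b i * Num.conj (b i') * G i i' n.
have off0 : rcvg off 0.
  apply: rcvg_sum0 => i _; apply: rcvg_sum0 => i' ii'.
  exact/rcvgMl0/delay_gramN.
have zz m : (rnorm (z m) ^+ 2)%:C = \sum_(i < N) \sum_(i' < N)
    b i * Num.conj (b i') * (Num.conj (delay i' w m) * delay i w m).
  rewrite -mul_conj_rnorm rmorph_sum big_distrlr /=.
  apply: eq_bigr => i _; apply: eq_bigr => i' _; rewrite rmorphM /=; ring.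
have zs n : (\sum_(0 <= m < n) rnorm (z m) ^+ 2)%:C =
    (\sum_(i < N) rnorm (b i) ^+ 2 * \sum_(0 <= m < n) rnorm (delay i w m) ^+ 2)%:C
    + off n.
  rewrite rmorph_sum; under eq_bigr do rewrite /= zz.
  rewrite exchange_big /= rmorph_sum -big_split /=; apply: eq_bigr => i _.
  rewrite exchange_big /= (bigD1 i) //= -!mulr_sumr.
  congr (_ + _); last by apply: eq_bigr => i' _; rewrite -mulr_sumr.
  rewrite mul_conj_rnorm [RHS]rmorphM [X in _ = _ * X]rmorph_sum; congr (_ * _).
  by apply: eq_bigr => m _; rewrite mulrC mul_conj_rnorm.
apply/ler_addgt0Pr => e e0; have /rcvgP/(_ _ e0)[Q offQ] := off0.
have {}offQ := offQ (maxn Q N) (leq_maxl _ _); rewrite subr0 in offQ.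
have le1 : \sum_(0 <= m < maxn Q N) rnorm (z m) ^+ 2 <=
    W * \sum_(0 <= i < N) rnorm (b i) ^+ 2 + e.
  have := congr1 (@complex.Re R) (zs (maxn Q N)); rewrite raddfD /= => ->.
  apply: lerD; last by apply: le_trans (Re_le_rnorm _) _; exact: ltW.
  rewrite big_mkord mulr_sumr; apply: ler_sum => i _.
  by rewrite mulrC ler_wpM2r ?sqr_ge0 //; exact: sqsum_delay.
apply: le_trans le1.
(* For j < N the terms of [z j] with i > j are zero, so [z j] is exactly the convolution; later
   entries of [z] only add energy. *)
rewrite (big_cat_nat (leq0n N) (leq_maxr Q N)) /=.
rewrite -[leLHS]addr0 lerD //; last by apply: sumr_ge0 => m _; rewrite sqr_ge0.
rewrite le_eqVlt; apply/orP; left; apply/eqP; apply: eq_big_nat => j /andP[_ jN].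
congr (rnorm _ ^+ 2); rewrite /z.
rewrite -(big_mkord xpredT (fun i => delay i w j * b i)).
rewrite [RHS](big_cat_nat (leq0n j.+1) jN) /= [X in _ = _ + X]big_nat.
rewrite [X in _ = _ + X]big1 ?addr0; last first.
  by move=> i /andP[ji _]; rewrite delay_lt ?mul0r.
by apply: eq_big_nat => i /andP[_ ij]; rewrite /delay -ltnS ij.
Qed.

(* The rectangle j < N, n < L is covered by antidiagonals d = n + j; on each of
   them the truncated sums form a convolution with w. *)
Lemma wandering_partial_energy w a W M N L :
  wandering w -> sqsum_le w W -> sqsum_le a M ->
  \sum_(0 <= j < N) \sum_(0 <= n < L)
    rnorm (\sum_(0 <= k < j.+1) w k * a (n + k)%N) ^+ 2 <= N%:R * (W * M).
Proof.
move=> ww wW aM; have W0 := sqsum_ge0 wW.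
(* With d = n + j and i = j - k, the term [w k * a (n + k)] becomes [w (j - i) * a (d - i)]; [delay]
   puts 0 where i > d. *)
pose F j d := rnorm (\sum_(0 <= i < j.+1) w (j - i)%N * delay i a d) ^+ 2.
have rowF j : (j < N)%N -> \sum_(0 <= n < L)
    rnorm (\sum_(0 <= k < j.+1) w k * a (n + k)%N) ^+ 2
    <= \sum_(0 <= d < L + N) F j d.
  move=> jN; have jL : (j <= L + N)%N by rewrite (leq_trans (ltnW jN)) ?leq_addl.
  have jLj : (j <= L + j)%N by rewrite leq_addl.
  have LjN : (L + j <= L + N)%N by rewrite leq_add2l ltnW.
  have F0 d : 0 <= F j d by rewrite sqr_ge0.
  rewrite (big_cat_nat (leq0n j) jL) (big_cat_nat jLj LjN) /=.
  have : \sum_(0 <= d < j) F j d >= 0 by apply: sumr_ge0.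
  have : \sum_(L + j <= d < L + N) F j d >= 0 by apply: sumr_ge0.
  suff -> : \sum_(0 <= n < L) rnorm (\sum_(0 <= k < j.+1) w k * a (n + k)%N) ^+ 2
      = \sum_(j <= d < L + j) F j d by lra.
  rewrite [RHS]sum_nat_shift addnK; apply: eq_bigr => n _.
  congr (rnorm _ ^+ 2); rewrite [LHS]big_nat_rev /= add0n.
  apply: eq_big_nat => i /andP[_ ij]; rewrite subSS /delay.
  have {}ij : (i <= j)%N by [].
  by rewrite ifT ?addnBA // (leq_trans ij) // leq_addl.
apply: le_trans (_ : \sum_(0 <= j < N) \sum_(0 <= d < L + N) F j d <= _).
  by apply: ler_sum_nat => j /andP[_ /rowF].
rewrite exchange_big /=.
(* For fixed [d] the sums over [i] form the convolution of [w] with [delay i a d] as a sequence in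
   [i]. *)
apply: le_trans (_ : \sum_(0 <= d < L + N)
   W * (\sum_(0 <= i < N) rnorm (delay i a d) ^+ 2) <= _).
  by apply: ler_sum => d _; exact: wandering_convolution.
rewrite -mulr_sumr mulrCA ler_wpM2l // exchange_big /=.
apply: le_trans (_ : \sum_(0 <= i < N) M <= _).
  by apply: ler_sum => i _; exact: sqsum_delay.
by rewrite sumr_const_nat subn0 mulr_natl.
Qed.

(** Averaging: if all rows from [J] on exceeded C + 1, the total over many rows would outgrow N
    C. *)
Lemma average_frequently (F : nat -> nat -> R) (C : R) :
  (forall j n, 0 <= F j n) ->
  (forall N L, \sum_(0 <= j < N) \sum_(0 <= n < L) F j n <= N%:R * C) ->
  forall J, exists2 j, (J <= j)%N & forall L, \sum_(0 <= n < L) F j n <= C + 1.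
Proof.
move=> F0 FC J; apply: contrapT => noj.
have /choice[l lP] j : exists l, (J <= j)%N -> C + 1 < \sum_(0 <= n < l) F j n.
  apply: contrapT => nol; apply: noj; exists j.
    by rewrite leqNgt; apply/negP => jJ; apply: nol; exists 0%N; rewrite leqNgt jJ.
  by move=> L; rewrite leNgt; apply/negP => lt_C; apply: nol; exists L.
(* As p > J C, the p rows after [J] contribute at least p (C + 1) > (J + p) C. The width [L] is
   large enough for each of them. *)
pose p := (Num.truncn (J%:R * C)).+1; pose N := (J + p)%N.
pose L := \max_(j < N) l j.
have JN : (J <= N)%N by rewrite leq_addr.
have := FC N L; rewrite (big_cat_nat (leq0n J) JN) /=.
have h0 : 0 <= \sum_(0 <= j < J) \sum_(0 <= n < L) F j n.
  by apply: sumr_ge0 => j _; apply: sumr_ge0.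
have h1 : p%:R * (C + 1) <= \sum_(J <= j < N) \sum_(0 <= n < L) F j n.
  have -> : p%:R * (C + 1) = \sum_(J <= j < N) (C + 1).
    by rewrite sumr_const_nat addKn mulr_natl.
  apply: ler_sum_nat => j /andP[Jj jN]; rewrite (le_trans (ltW (lP j Jj))) //.
  have lL : (l j <= L)%N by exact: (leq_bigmax (Ordinal jN)).
  by rewrite (big_cat_nat (leq0n _) lL) /= lerDl sumr_ge0.
have h2 : J%:R * C < p%:R by rewrite truncnS_gt.
have -> : N%:R = J%:R + p%:R :> R by rewrite -natrD.
by move: h1; rewrite mulrDr mulr1 mulrDl; lra.
Qed.

End Wandering.

(** * Kernels of synthesis operators of iterates *)

Section Iterates.
Variables (R : realType) (H : completeNormedModType R[i]).
Variable dot : {dot H for @Num.conj R[i]}.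
Hypothesis dot_norm : forall x : H, dot x x = `|x| ^+ 2.
Variable T : {linear H -> H}.
Hypothesis bndT : bounded_operators T.
Implicit Types (f h x y g : H) (c d w : nat -> R[i]).

Definition iterates f : nat -> H := fun n => iter n T f.

Lemma iter_linear0 n : iter n T 0 = 0.
Proof. by elim: n => //= n ->; rewrite linear0. Qed.

Lemma synthesis_shift f c x j : synthesis (iterates f) c x ->
  synthesis (fun n => iterates f (n + j)%N) c (iter j T x).
Proof.
move=> fx; elim: j => [|j IH] /=; first by under eq_fun do rewrite addn0.
by under eq_fun do rewrite addnS; exact: (synthesis_image bndT).
Qed.

Lemma synthesis_delay f c x : synthesis (iterates f) c x ->
  synthesis (iterates f) (delay 1 c) (T x).
Proof.
move=> /(synthesis_image bndT) fx; apply/(rcvg_addn _ _ 1).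
move: fx; congr rcvg; apply/funext => n.
rewrite addn1 [RHS]big_nat_recl //= /delay /= scale0r add0r.
by apply: eq_bigr => k _; rewrite subn1.
Qed.

Lemma synthesis_delta f :
  synthesis (iterates f) (fun k => (k == 0%N)%:R) f.
Proof.
apply/(rcvg_addn _ _ 1); have := rcvg_cst f; congr rcvg; apply/funext => n.
rewrite addn1 big_nat_recl //= scale1r big1 ?addr0 // => k _.
by rewrite scale0r.
Qed.

(** The condition on [y] puts the left shift of [w] in the range of the analysis operator of the
    orbit of [f], which makes [w] orthogonal to S (ker U_f). *)
Lemma wandering_synthesis f h A B D w y W :
  frame_bounds dot (iterates f) A B -> bessel dot (iterates h) D ->
  sqsum_le w W -> synthesis (iterates f) w 0 ->
  (forall n, w n.+1 = dot y (iterates f n)) -> synthesis (iterates h) w 0.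
Proof.
move=> fAB hD wW fw wy; have [A0 fB _] := fAB.
(* Pairing [y] with T^j U_f w = 0 yields the sum of the conj(w_k) <y, T^(k+j) f>, and the last
   factor is w_(k+j+1). *)
have ww : wandering w.
  move=> j; have := dot_synthesis dot_norm y (synthesis_shift j fw).
  rewrite iter_linear0 dotr0; congr rcvg; apply/funext => n.
  by apply: eq_bigr => k _; rewrite addnS wy.
have [x hx _] := synthesis_exists dot_norm hD wW.
suff <- : x = 0 by [].
apply: (dot_eq0 dot_norm) => g; rewrite dotC; apply/eqP; rewrite conjC_eq0; apply/eqP.
(* [s j n] is the truncation w_0 + ... + w_(j-1) T^(j-1) applied to T^n f and tested against [g]. *)
pose a m := dot (iterates f m) g; pose s j n := \sum_(0 <= k < j) w k * a (n + k)%N.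
have aM : sqsum_le a (B * rnorm g ^+ 2).
  by move=> n; under eq_bigr do rewrite rnorm_dotC; exact: (proj2 fB).
have [e [fd dD]] := canonical_dual dot_norm h fAB.
set d := fun k => dot e (iterates f k) in fd dD; set D' := _ / A in dD.
pose th j := dot (\sum_(0 <= k < j) w k *: iterates h k) g.
have thx : rcvg th (dot x g) by exact: rcvg_dotl.
(* Inserting the expansion of T^k h in the vectors T^(m+k) f and exchanging the sums. *)
have ths j : rcvg (fun n => \sum_(0 <= k < n) d k * s j k) (th j).
  have : rcvg (fun n => \sum_(0 <= k < j) w k *:
      \sum_(0 <= m < n) d m *: iterates f (m + k)%N) (\sum_(0 <= k < j) w k *: iterates h k).
    by apply: rcvg_sum => k _; apply: rcvgZ; exact: synthesis_shift.
  move=> /(rcvg_dotl dot_norm g); congr rcvg; apply/funext => n.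
  under eq_bigr do rewrite scaler_sumr.
  rewrite exchange_big /= dot_suml; apply: eq_bigr => k _.
  rewrite dot_suml mulr_sumr; apply: eq_bigr => m _.
  by rewrite !dotZl mulrCA.
have s0 n : rcvg (fun j => s j n) 0.
  have := rcvg_dotl dot_norm g (synthesis_shift n fw).
  rewrite iter_linear0 dotC dotr0 rmorph0; congr rcvg; apply/funext => j.
  by rewrite dot_suml; apply: eq_bigr => k _; rewrite dotZl addnC.
pose C := W * (B * rnorm g ^+ 2).
have C0 : 0 <= C by rewrite mulr_ge0 ?(sqsum_ge0 wW) ?(sqsum_ge0 aM).
have freq := @average_frequently R (fun j n => rnorm (s j.+1 n) ^+ 2) C
  (fun _ _ => sqr_ge0 _) (fun N L => wandering_partial_energy N L ww wW aM).
apply: rnorm_eq0; apply/eqP; rewrite eq_le rnorm_ge0 andbT.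
apply/ler_addgt0Pr => e0 e0_gt0; rewrite add0r.
(* One third each for the head n < P, for the tail, and for the distance from [th j.+1] to its
   limit. The tail needs only the uniform energy bound C + 1, so [P] is fixed before [j]. *)
pose eps := e0 / 3; have eps0 : 0 < eps by rewrite divr_gt0.
have epsC : 0 < eps ^+ 2 / (C + 1) by rewrite divr_gt0 ?exprn_gt0 //; lra.
have [P dP] := sqsum_tail_small dD epsC.
have /rcvgP/(_ _ eps0)[J1 sJ1] : rcvg (fun j => \sum_(0 <= n < P) d n * s j n) 0.
  by apply: rcvg_sum0 => n _; exact: rcvgMl0.
have /rcvgP/(_ _ eps0)[J2 thJ2] := thx.
have [j Jj sj] := freq (maxn J1 J2).
have J1j : (J1 <= j.+1)%N by rewrite (leq_trans (leq_maxl _ J2)) // ltnW.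
have J2j : (J2 <= j.+1)%N by rewrite (leq_trans (leq_maxr J1 _)) // ltnW.
have := sJ1 _ J1j; rewrite subr0 => hJ1; have hJ2 := thJ2 _ J2j.
have hth : rnorm (th j.+1) <= 2 * eps.
  apply: rcvg_rnorm_le ((rcvg_addn _ _ P).2 (ths j.+1)) _ => n.
  rewrite (big_cat_nat (leq0n P) (leq_addl n P)) /=.
  suff : rnorm (\sum_(P <= k < n + P) d k * s j.+1 k) <= eps.
    have := rnormD (\sum_(0 <= k < P) d k * s j.+1 k)
      (\sum_(P <= k < n + P) d k * s j.+1 k).
    lra.
  rewrite -ler_sqr ?nnegrE ?rnorm_ge0 ?(ltW eps0) //.
  rewrite (le_trans (rnorm_sumM _ _ _)) //.
  have -> : eps ^+ 2 = eps ^+ 2 / (C + 1) * (C + 1) by rewrite divfK // lt0r_neq0; lra.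
  rewrite ler_pM ?sumr_ge0 // => [k _|k _||].
  - exact: sqr_ge0.
  - exact: sqr_ge0.
  - exact/ltW/dP.
  - exact: (sqsum_tail_le P (n + P) sj).
have := rnormB (th j.+1) (th j.+1 - dot x g).
by rewrite opprB addrCA subrr addr0 /eps in hth hJ2 *; lra.
Qed.

(** [c'] is the orthogonal projection onto ker U_f of the left shift [d] of [c], namely [d] minus
    the canonical dual coefficients of U_f d. Then w = c - S c' falls under [wandering_synthesis],
    so U_h c = U_h (S c') = T (U_h c'). *)
Lemma kernel_step f h A B D c M x :
  frame_bounds dot (iterates f) A B -> bessel dot (iterates h) D ->
  sqsum_le c M -> synthesis (iterates f) c 0 -> synthesis (iterates h) c x ->
  exists c' x', [/\ sqsum_le c' M, synthesis (iterates f) c' 0,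
    synthesis (iterates h) c' x' & x = T x'].
Proof.
move=> fAB hD cM fc hx; have [A0 fB _] := fAB.
pose d n := c n.+1.
have dM : sqsum_le d M.
  by have := sqsum_addn 1 cM; rewrite /d; under eq_fun do rewrite addn1.
have [z fd _] := synthesis_exists dot_norm fB dM.
have [y [fy yE]] := canonical_dual dot_norm z fAB.
pose c' n := d n - dot y (iterates f n).
have fc' : synthesis (iterates f) c' 0 by rewrite -(subrr z); exact: synthesisB.
have c'M : sqsum_le c' M.
  (* Pythagoras holds only in the limit: the cross term is made smaller than e / 2 at some m >= n,
     where the partial energies are compared. *)
  move=> n; apply/ler_addgt0Pr => e e0.
  have := dot_synthesis dot_norm y fc'; rewrite dotr0 => /rcvgP c'y.
  have e2 : 0 < e / 2 by rewrite divr_gt0.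
  have [N hN] := c'y _ e2.
  have := hN _ (leq_maxr n N); rewrite subr0; set m := maxn n N => hm.
  have nm : (n <= m)%N by rewrite leq_maxl.
  have := dM m.
  have -> : \sum_(0 <= k < m) rnorm (d k) ^+ 2 =
     \sum_(0 <= k < m) rnorm (c' k) ^+ 2 +
     \sum_(0 <= k < m) rnorm (dot y (iterates f k)) ^+ 2 +
     2 * complex.Re (\sum_(0 <= k < m) Num.conj (c' k) * dot y (iterates f k)).
    rewrite raddf_sum mulr_sumr -!big_split /=; apply: eq_bigr => k _.
    by rewrite -rnorm_sqrD subrK.
  have hRe : - complex.Re (\sum_(0 <= k < m) Num.conj (c' k) * dot y (iterates f k)) < e / 2.
    by rewrite -raddfN (le_lt_trans (Re_le_rnorm _)) // rnormN.
  have : 0 <= \sum_(0 <= k < m) rnorm (dot y (iterates f k)) ^+ 2.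
    by apply: sumr_ge0 => k _; rewrite sqr_ge0.
  have : \sum_(0 <= k < n) rnorm (c' k) ^+ 2 <= \sum_(0 <= k < m) rnorm (c' k) ^+ 2.
    by rewrite (big_cat_nat (leq0n n) nm) /= lerDl sumr_ge0 // => k _; rewrite sqr_ge0.
  lra.
pose w n := c n - delay 1 c' n.
have wy n : w n.+1 = dot y (iterates f n).
  by rewrite /w /delay /= subn1 /= /c' opprB addrC subrK.
have fw : synthesis (iterates f) w 0.
  by rewrite -(subrr 0) -{2}(linear0 T); exact/synthesisB/synthesis_delay.
have [W wW] : exists W, sqsum_le w W.
  by eexists; apply: sqsumD cM _; apply/sqsumN/sqsum_delay; exact: c'M.
have hw := wandering_synthesis fAB hD wW fw wy.
have [x' hx' _] := synthesis_exists dot_norm hD c'M.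
exists c', x'; split=> //.
have := synthesisB hx (synthesis_delay hx') => /(synthesis_unique hw) /eqP.
by rewrite eq_sym subr_eq0 => /eqP.
Qed.

Lemma kernel_sub f h A B D c M :
  frame_bounds dot (iterates f) A B -> bessel dot (iterates h) D ->
  sqsum_le c M -> synthesis (iterates f) c 0 -> synthesis (iterates h) c 0.
Proof.
move=> fAB hD cM fc.
have [x hx _] := synthesis_exists dot_norm hD cM.
have iterx j : exists c' x', [/\ sqsum_le c' M, synthesis (iterates f) c' 0,
    synthesis (iterates h) c' x' & x = iter j T x'].
  elim: j => [|j [c' [x' [c'M fc' hx' ->]]]]; first by exists c, x.
  have [c2 [x2 [c2M fc2 hx2 ->]]] := kernel_step fAB hD c'M fc' hx'.
  by exists c2, x2; rewrite iterSr.
suff <- : x = 0 by [].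
apply: (dot_eq0 dot_norm) => g; have M0 := sqsum_ge0 cM.
apply: rnorm_eq0; apply/eqP; rewrite eq_le rnorm_ge0 andbT.
apply/ler_addgt0Pr => e e0; rewrite add0r.
have eM : 0 < e ^+ 2 / (M + 1) by rewrite divr_gt0 ?exprn_gt0 //; lra.
(* [N] depends on [g] and [M] alone, and [M] bounds the coefficients at every stage, so
   Cauchy-Schwarz makes <g, T^N x'> at most [e]. *)
have [N gN] := sqsum_tail_small (proj2 hD g) eM.
have [c' [x' [c'M _ hx' ->]]] := iterx N.
have := dot_synthesis dot_norm g (synthesis_shift N hx') => /rcvg_rnorm_le; apply => n.
rewrite -ler_sqr ?nnegrE ?rnorm_ge0 ?(ltW e0) //.
rewrite (le_trans (rnorm_sumM _ _ _)) //.
have -> : e ^+ 2 = (M + 1) * (e ^+ 2 / (M + 1)) by rewrite mulrC divfK // lt0r_neq0; lra.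
rewrite ler_pM ?sumr_ge0 // => [k _|k _||].
- exact: sqr_ge0.
- exact: sqr_ge0.
- under eq_bigr do rewrite rnormC.
  by rewrite (le_trans (c'M n)) // lerDl.
- have := gN N (n + N)%N (leqnn N); rewrite sum_nat_shift addnK.
  exact: ltW.
Qed.

End Iterates.

(** * Frame generators *)

Section Generators.
Variables (R : realType) (H : completeNormedModType R[i]).
Variable dot : {dot H for @Num.conj R[i]}.
Hypothesis dot_norm : forall x : H, dot x x = `|x| ^+ 2.
Variable T : {linear H -> H}.
Hypothesis bndT : bounded_operators T.
Implicit Types (f h x y g : H) (c : nat -> R[i]).

(** V is defined through canonical dual coefficients; any other square-summable expansion of the
    same vector differs by an element of ker U_f, which [kernel_sub] sends to 0. Linearity follows
    from this independence. *)
Lemma frame_transfer f h A B D :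
  frame_bounds dot (iterates T f) A B -> bessel dot (iterates T h) D ->
  exists2 V : {linear H -> H}, bounded_operators V &
    forall c M x, sqsum_le c M ->
      synthesis (iterates T f) c x -> synthesis (iterates T h) c (V x).
Proof.
move=> fAB hD; have [A0 fB _] := fAB; have D0 := proj1 hD.
have /choice[F FP] x : exists v, (forall c M, sqsum_le c M ->
      synthesis (iterates T f) c x -> synthesis (iterates T h) c v) /\
    rnorm v ^+ 2 <= D * (rnorm x ^+ 2 / A).
  have [y [fy yM]] := canonical_dual dot_norm x fAB.
  have [v hv vM] := synthesis_exists dot_norm hD yM.
  exists v; split=> // c M cM fc.
  have fcy := synthesisB fc fy; rewrite subrr in fcy.
  have cyM := sqsumD cM (sqsumN yM).
  have := synthesisD (kernel_sub dot_norm bndT fAB hD cyM fcy) hv.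
  by rewrite add0r; under eq_fun do rewrite subrK.
have coef x : exists c, exists2 M, sqsum_le c M & synthesis (iterates T f) c x.
  have [y [fy yM]] := canonical_dual dot_norm x fAB.
  by eexists; eexists; [exact: yM|].
have Flin : linear F.
  move=> a x z; have [c [M cM fc]] := coef x; have [c' [M' c'M fc']] := coef z.
  have := synthesisD (synthesisZ a ((FP x).1 _ _ cM fc)) ((FP z).1 _ _ c'M fc').
  apply: synthesis_unique; apply: (FP _).1; last first.
    by apply: synthesisD fc'; exact: synthesisZ.
  by apply: sqsumD c'M; exact: sqsumZ cM.
pose V : {linear H -> H} := HB.pack F (GRing.isLinear.Build _ _ _ _ F Flin).
exists V => [|c M x cM fc]; last exact: (FP x).1 cM fc.
exists (Num.sqrt (D / A)) => x /=.
rewrite -ler_sqr ?nnegrE ?mulr_ge0 ?rnorm_ge0 ?sqrtr_ge0 // exprMn.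
rewrite sqr_sqrtr ?divr_ge0 ?(ltW A0) ?(ltW D0) //.
by rewrite mulrAC -mulrA; exact: (FP x).2.
Qed.

(** The transfers from [f] to [h] and back undo each other on coefficients. V commutes with T since
    T acts on both sides as the shift of coefficients, and the first unit sequence gives V f = h. *)
Lemma generator_image f h : frame_generators dot T f -> frame_generators dot T h ->
  exists2 V, (commutant T `&` GL H) V & V f = h.
Proof.
move=> /frameP[A [B fAB]] /frameP[A' [B' hAB]].
have [_ fB _] := fAB; have [_ hB _] := hAB.
have [V bV VP] := frame_transfer fAB hB.
have [W _ WP] := frame_transfer hAB fB.
exists V.
  split; split=> //.
    move=> x; have [y [fy yM]] := canonical_dual dot_norm x fAB.
    apply: synthesis_unique (synthesis_delay bndT (VP _ _ _ yM fy)).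
    apply: VP _ _ _ (sqsum_delay _ yM) _; exact: (synthesis_delay bndT).
  exists W => x.
    have [y [fy yM]] := canonical_dual dot_norm x fAB.
    exact: synthesis_unique (WP _ _ _ yM (VP _ _ _ yM fy)) fy.
  have [y [hy yM]] := canonical_dual dot_norm x hAB.
  exact: synthesis_unique (VP _ _ _ yM (WP _ _ _ yM hy)) hy.
apply: synthesis_unique (synthesis_delta T h).
apply: (VP _ 1 _ _ (synthesis_delta T f)) => -[|n]; first by rewrite big_nil.
rewrite big_nat_recl //= big1 ?addr0 => [|k _]; last by rewrite rnorm0 expr0n.
by rewrite (rnorm_real 1) normr1 expr1n.
Qed.

(** The partial energy E equals <g, V x> with x = sum of c_k f_k, and |x|^2 <= B E by [bessel_sum];
    so E^2 <= K'^2 B |g|^2 E. *)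
Lemma bessel_image (V : {linear H -> H}) (f : nat -> H) B : bounded_operators V ->
  bessel dot f B -> exists D, bessel dot (V \o f) D.
Proof.
move=> [K VK] fB; have B0 := proj1 fB; pose K' := `|K| + 1.
have K0 : 0 < K' by rewrite ltr_wpDl.
have VK' x : rnorm (V x) <= K' * rnorm x.
  rewrite (le_trans (VK x)) // ler_wpM2r ?rnorm_ge0 //.
  by rewrite (le_trans (ler_norm K)) // lerDl.
exists (K' ^+ 2 * B); split=> [|g n]; first by rewrite mulr_gt0 // exprn_gt0.
set E := \sum_(0 <= k < n) _; pose c k := dot g (V (f k)).
have E0 : 0 <= E by apply: sumr_ge0 => k _; rewrite sqr_ge0.
pose x := \sum_(0 <= k < n) c k *: f k.
have gx : dot g (V x) = E%:C.
  rewrite linear_sum dot_sumr rmorph_sum; apply: eq_bigr => k _.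
  by rewrite linearZ dotZr mulrC mul_conj_rnorm.
have Ele : E <= rnorm g * (K' * rnorm x).
  rewrite -(ger0_norm E0) -rnorm_real -gx.
  by rewrite (le_trans (dot_CauchySchwarz dot_norm _ _)) // ler_wpM2l ?rnorm_ge0.
have xE : rnorm x ^+ 2 <= B * E := bessel_sum dot_norm c 0 n fB.
have EE : E ^+ 2 <= rnorm g ^+ 2 * (K' ^+ 2 * (B * E)).
  apply: le_trans (_ : (rnorm g * (K' * rnorm x)) ^+ 2 <= _).
    by rewrite ler_sqr ?nnegrE // !mulr_ge0 ?rnorm_ge0 // ltW.
  by rewrite !exprMn ler_wpM2l ?sqr_ge0 // ler_wpM2l ?sqr_ge0.
have [E00|E00] := eqVneq E 0.
  by rewrite E00 mulr_ge0 ?sqr_ge0 // mulr_ge0 ?sqr_ge0 // ltW.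
have Ep : 0 < E by rewrite lt_neqAle eq_sym E00.
rewrite -(ler_pM2r Ep) -expr2.
by have -> : K' ^+ 2 * B * rnorm g ^+ 2 * E = rnorm g ^+ 2 * (K' ^+ 2 * (B * E)) by ring.
Qed.

Lemma frame_image (V : {linear H -> H}) (f : nat -> H) : GL H V ->
  frame dot f -> frame dot (V \o f).
Proof.
move=> [bV [W _ WK]] /frameP[A [B fAB]]; have [A0 fB _] := fAB.
have [D VfD] := bessel_image bV fB.
(* Expanding W y in [f] and applying V expands y itself in the vectors V f_k, with coefficients of
   energy at most |W y|^2 / A. *)
have pair g M y : sqsum_le (fun k => dot g (V (f k))) M ->
    rnorm (dot g y) ^+ 2 <= rnorm (W y) ^+ 2 / A * M.
  move=> gM; have [z [fz zM]] := canonical_dual dot_norm (W y) fAB.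
  have /(dot_synthesis dot_norm g) := synthesis_image bV fz; rewrite WK => gy.
  have A1 : 0 <= rnorm (W y) ^+ 2 / A * M.
    by rewrite mulr_ge0 ?(sqsum_ge0 gM) // divr_ge0 ?sqr_ge0 // ltW.
  rewrite -(sqr_sqrtr A1) ler_sqr ?nnegrE ?rnorm_ge0 ?sqrtr_ge0 //.
  apply: rcvg_rnorm_le gy _ => n.
  rewrite -(ger0_norm (rnorm_ge0 _)) -sqrtr_sqr ler_wsqrtr //.
  rewrite (le_trans (rnorm_sumM _ _ _)) //.
  rewrite ler_pM ?sumr_ge0 // => [k _|k _|]; try exact: sqr_ge0.
  by under eq_bigr do rewrite rnormC; exact: zM.
(* By [pair], the vectors of energy at most 1 are bounded against each fixed [y], hence bounded in
   norm. *)
have [|K GK] := @weakly_bounded_bounded R H dot dot_norm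
    [set g | sqsum_le (fun k => dot g (V (f k))) 1].
  move=> y; exists (Num.sqrt (rnorm (W y) ^+ 2 / A)) => g /(pair _ _ y).
  by rewrite mulr1 => h; rewrite -(ger0_norm (rnorm_ge0 _)) -sqrtr_sqr ler_wsqrtr.
pose K' := `|K| + 1; have K0 : 0 < K' by rewrite ltr_wpDl.
apply/frameP; exists (K' ^- 2), D; split=> //.
  by rewrite invr_gt0 exprn_gt0.
move=> g M gM; apply/ler_addgt0Pr => e e0; have M0 := sqsum_ge0 gM.
have s0 : 0 < M + e by rewrite ltr_wpDl.
rewrite mulrC ler_pdivrMr ?exprn_gt0 //.
(* Rescaling brings the energy of [g] to at most 1; the added [e] covers M = 0. *)
have := GK ((Num.sqrt (M + e))^-1%:C *: g) _.
rewrite rnormZ rnorm_real ger0_norm ?invr_ge0 ?sqrtr_ge0 // => GKg.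
have {}GKg : rnorm g <= Num.sqrt (M + e) * K'.
  rewrite -ler_pdivrMl ?sqrtr_gt0 // (le_trans (GKg _)) //; last first.
    by rewrite (le_trans (ler_norm K)) // lerDl.
  move=> n; under eq_bigr do rewrite dotZl.
  apply: le_trans (sqsumZ _ gM n) _.
  rewrite rnorm_real ger0_norm ?invr_ge0 ?sqrtr_ge0 // exprVn sqr_sqrtr ?(ltW s0) //.
  by rewrite ler_pdivrMl // mulr1 lerDl ltW.
rewrite -[X in X * _]sqr_sqrtr ?(ltW s0) // -exprMn.
by rewrite ler_sqr ?nnegrE ?rnorm_ge0 // mulr_ge0 ?sqrtr_ge0 // ltW.
Qed.

End Generators.

Theorem proposition3p8 (R : realType) (H : completeNormedModType R[i])
    (dot : {dot H for @Num.conj R[i]})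
    (dot_norm : forall x : H, dot x x = `|x| ^+ 2)
    (sepH : separable H) (infH : infinite_dimensional H)
    (T : {linear H -> H}) (bndT : bounded_operators T)
    (f0 : H) (f0T : frame_generators dot T f0) :
  frame_generators dot T = [set V f0 | V in commutant T `&` GL H].
Proof.
apply/seteqP; split=> [h hT|_ [V [[_ VT] GLV] <-]].
  exact: generator_image.
rewrite /frame_generators /=.
have -> : (fun n => iter n T (V f0)) = V \o (fun n => iter n T f0).
  by apply/funext; elim=> //= n ->; rewrite VT.
exact: frame_image.
Qed.
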